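(* The complete bipartite graph $K_{2,3}$ and the complete tripartite graph $K_{1,1,3}$ are contractible.
   Context: All graphs are finite and simple (no loops or multiple edges). Let $G$ and $H$ be graphs with $V(H)\subseteq V(G)$. An $H$-scheme in $G$ is a collection of paths $\{P_{uv}: uv\in E(H)\}$ such that (1) each $P_{uv}$ is a $u,v$-path in $G$ with $V(P_{uv})\cap V(H)=\{u,v\}$, and (2) whenever $e_1,\dots,e_k\in E(H)$ satisfy $V(P_{e_1})\cap\dots\cap V(P_{e_k})\neq\emptyset$, there is a vertex $u\in V(H)$ incident with each of $e_1,\dots,e_k$. $G$ has a rooted $H$-minor if there are pairwise vertex-disjoint connected subgraphs $C_v$ of $G$, one for each $v\in V(H)$, such that $v\in V(C_v)$ for all $v\in V(H)$ and for each edge $uv\in E(H)$ there is an edge of $G$ joining $C_u$ and $C_v$. A graph $H$ is contractible if every graph $G$ with $V(H)\subseteq V(G)$ that contains an $H$-scheme has a rooted $H$-minor. *)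

(* Defs.v *)
From mathcomp Require Import all_boot.

Set Implicit Arguments.
Unset Strict Implicit.
Unset Printing Implicit Defensive.

Record sgraph := SGraph {
  vertex :> finType;
  adj : rel vertex;
  adj_sym : symmetric adj;
  adj_irrefl : irreflexive adj
}.

Definition edges (G : sgraph) : {set {set G}} :=
  [set e | [exists x, exists y, adj x y && (e == [set x; y])]].

Record subgraph (G : sgraph) := Subgraph {
  sub_verts : {set G};
  sub_adj : rel G;
  sub_adj_sym : symmetric sub_adj;
  sub_adjP : forall x y, sub_adj x y ->
    [/\ x \in sub_verts, y \in sub_verts & adj x y]
}.

Definition connected_subgraph (G : sgraph) (C : subgraph G) : Prop :=
  sub_verts C != set0 /\
  {in sub_verts C &, forall x y, connect (sub_adj C) x y}.

Definition path_from_to (G : sgraph) (x y : G) (s : seq G) : bool :=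
  if s is z :: p then [&& z == x, path (@adj G) z p, last z p == y & uniq s]
  else false.

(* Paths are unoriented: the vertices may be listed from either end. *)
Definition uv_path (G : sgraph) (x y : G) (s : seq G) : bool :=
  path_from_to x y s || path_from_to y x s.

Section Rooted.

(* The inclusion of V(H) in V(G) is represented by an injection f : H -> G,
   assumed injective in [contractible]; H need not be a subgraph of G. *)
Variables (H G : sgraph) (f : H -> G).

(* P e is the path assigned to the edge e; its values outside [edges H] are
   irrelevant. *)
Definition is_scheme (P : {set H} -> seq G) : Prop :=
  (forall u v : H, adj u v ->
     uv_path (f u) (f v) (P [set u; v]) /\
     [set x in P [set u; v]] :&: [set f w | w : H] = [set f u; f v]) /\
  (forall A : {set {set H}}, A != set0 -> A \subset edges H ->
     \bigcap_(e in A) [set x in P e] != set0 ->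
     exists u : H, forall e, e \in A -> u \in e).

Definition has_rooted_minor : Prop :=
  exists C : H -> subgraph G,
    [/\ forall v, connected_subgraph (C v),
        forall u v, u != v -> [disjoint sub_verts (C u) & sub_verts (C v)],
        forall v, f v \in sub_verts (C v)
      & forall u v, adj u v ->
          exists x y, [/\ x \in sub_verts (C u), y \in sub_verts (C v)
                        & adj x y]].

End Rooted.

Definition contractible (H : sgraph) : Prop :=
  forall (G : sgraph) (f : H -> G), injective f ->
    (exists P, is_scheme f P) -> has_rooted_minor f.

(* The complete multipartite graph with part sizes s: the i-th part is
   'I_(nth 0 s i), and vertices are adjacent iff they lie in distinct parts. *)
Section CompleteMultipartite.

Variable s : seq nat.

Definition multi_vertex : finType := {i : 'I_(size s) & 'I_(nth 0 s i)}.

Definition multi_adj : rel multi_vertex := fun x y => tag x != tag y.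

Lemma multi_adj_sym : symmetric multi_adj.
Proof. by move=> x y; rewrite /multi_adj eq_sym. Qed.

Lemma multi_adj_irrefl : irreflexive multi_adj.
Proof. by move=> x; rewrite /multi_adj eqxx. Qed.

Definition complete_multipartite : sgraph :=
  SGraph multi_adj_sym multi_adj_irrefl.

End CompleteMultipartite.

(* Main.v *)
Require Import Defs.
From mathcomp Require Import all_boot.
From mathcomp Require Import zify.
From mathcomp Require Import ssralg matrix mxalgebra rat.

(** Let a, b be the two hubs and x_i the remaining vertices.  The scheme gives
  walks A_i from a to x_i and B_i from b to x_i such that A_i and B_j are
  disjoint for i <> j.  Contracting edges of the walks, one reaches a situation
  where no two consecutive vertices of A_i (or of B_i) are common to A_i and
  B_i, and where every vertex that is only on A-walks (B-walks) and different
  from a (b) lies on at least two of them.  A crossing z <> x_i of A_i and B_i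
  then joins its two neighbours on A_i, and also its two neighbours on B_i, so
  the crossings are the edges of two graphs, on the A-only and on the B-only
  vertices.  After contracting a set U of crossings, every component of the
  first graph not containing a is entered by two crossings, hence its rank is
  at most half the number of crossings left, and the same holds for the second
  graph.  By the matroid union theorem the crossings split into a set
  connecting the A-only vertices and a set connecting the B-only vertices:
  these are the bags of a and b, and those of the x_i are singletons.

  If a and b are adjacent in H, contracting an initial segment of their path
  into a makes a adjacent to a vertex w which is only on B-walks.  The
  contractions can be chosen so that such a vertex is never lost, and w ends up
  in the bag of b. *)

Set Implicit Arguments.
Unset Strict Implicit.
Unset Printing Implicit Defensive.

(** * Matroid union *)

Section MatroidUnion.
Variable T : finType.
Implicit Types (r : {set T} -> nat) (E F U W : {set T}) (z : T).

(** Monotone submodular functions are closed under the contraction [U |-> r (U :|: K)]; [r K] is not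
    subtracted, because additive constants cancel in [packable] and [packed]. *)
Definition rank_like r :=
  (forall U W, U \subset W -> r U <= r W) /\
  (forall U W, r (U :|: W) + r (U :&: W) <= r U + r W).

Lemma rank_like_contract r K : rank_like r -> rank_like (fun U => r (U :|: K)).
Proof.
case=> mono sub; split=> [U W sUW|U W]; first by apply: mono; apply: setSU.
by have:= sub (U :|: K) (W :|: K); rewrite -setUUl -setUIl.
Qed.

Lemma rank_like_span r F U W :
  rank_like r -> F \subset U -> r F = r U -> r (F :|: W) = r (U :|: W).
Proof.
case=> mono sub sFU eFU; apply/eqP; rewrite eqn_leq mono ?setSU //=.
have := sub (F :|: W) U.
have -> : F :|: W :|: U = U :|: W.
  by rewrite setUAC (setUidPr sFU).
have : r F <= r ((F :|: W) :&: U) by apply: mono; rewrite subsetI subsetUl.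
by rewrite eFU; lia.
Qed.

(** Edmonds' rank condition for two disjoint sets, one spanning for each rank function. *)
Definition packable r1 r2 E :=
  forall U, U \subset E -> r1 E + r2 E <= #|E :\: U| + r1 U + r2 U.

Definition packed r1 r2 E :=
  exists2 F : {set T}, F \subset E & r1 F = r1 E /\ r2 (E :\: F) = r2 E.

Lemma packableC r1 r2 E : packable r1 r2 E -> packable r2 r1 E.
Proof. by move=> H U /H; lia. Qed.

Lemma packedC r1 r2 E : packed r1 r2 E -> packed r2 r1 E.
Proof.
case=> F sFE [e1 e2]; exists (E :\: F); first exact: subsetDl.
by rewrite setDDr setDv set0U (setIidPr sFE).
Qed.

Lemma cardsD_chain E U W :
  W \subset U -> U \subset E -> #|E :\: W| = #|E :\: U| + #|U :\: W|.
Proof.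
move=> sWU sUE; rewrite !cardsD (setIidPr sUE) (setIidPr sWU).
rewrite (setIidPr (subset_trans sWU sUE)).
by have := subset_leq_card sWU; have := subset_leq_card sUE; lia.
Qed.

(* z is deleted from the first matroid and contracted in the second one. *)
Lemma packed_delete r1 r2 E z :
    rank_like r1 -> rank_like r2 ->
    (forall r1 r2 E', rank_like r1 -> rank_like r2 -> #|E'| < #|E| ->
       packable r1 r2 E' -> packed r1 r2 E') ->
    packable r1 r2 E -> z \in E ->
    (forall U, U \subset E -> U != set0 -> U != E ->
       r1 E + r2 E < #|E :\: U| + r1 U + r2 U) ->
    r1 E + r2 E < #|E| + r1 set0 + r2 [set z] ->
  packed r1 r2 E.
Proof.
move=> R1 R2 IH pE zE slack slack0.
have [mono1 _] := R1; have [mono2 _] := R2.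
have sE' : E :\ z \subset E by exact: subD1set.
have eE : (E :\ z) :|: [set z] = E by rewrite setUC setD1K.
have cE : #|E| = #|E :\ z|.+1 by rewrite (cardsD1 z) zE.
have sz : [set z] \subset E by rewrite sub1set.
(* The strict inequality at [E :\ z] leaves no room for [r1] to drop when [z] is deleted. *)
have r1E' : r1 (E :\ z) = r1 E.
  have := mono1 _ _ sE'; have := mono2 _ _ sE'; have := mono2 _ _ sz.
  have [E0|Epos] := eqVneq (E :\ z) set0.
    by move: slack0; rewrite cE E0 cards0; lia.
  have := slack _ sE' Epos; rewrite setDDr setDv set0U (setIidPr sz) cards1.
  have /[swap]/[apply] : E :\ z != E.
    by apply/eqP => E_z; move: zE; rewrite -E_z !inE eqxx.
  lia.
have [|W sW|F sF [e1 e2]] :=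
    IH r1 (fun U => r2 (U :|: [set z])) (E :\ z) R1 (rank_like_contract [set z] R2).
- by rewrite cE.
- rewrite eE r1E'.
  have [->|W0] := eqVneq W set0.
    by rewrite set0U setD0; move: slack0; rewrite cE; lia.
  have [->|WE] := eqVneq W (E :\ z); first by rewrite eE r1E'; lia.
  have zW : z \notin W
    by apply: contraL sW => zW; apply/negP=> /subsetP/(_ z zW); rewrite !inE eqxx.
  have sWE := subset_trans sW sE'.
  have WnE : W != E by apply: contraNneq zW => ->.
  (* Strictness at [W] makes up for the element [z] lost from [E :\: W]. *)
  have := slack _ sWE W0 WnE.
  have := mono2 _ _ (subsetUl W [set z]).
  rewrite (cardsD_chain sW sE') setDDr setDv set0U (setIidPr sz) cards1.
  lia.
exists F; first exact: subset_trans sF sE'.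
split; first by rewrite e1.
rewrite -eE -e2 /=; congr r2; apply/setP=> y; rewrite !inE.
have [->|//] := eqVneq y z; rewrite ?andbF ?orbF ?andbT ?orbT //=.
by apply/negP=> /(subsetP sF); rewrite !inE eqxx.
Qed.

(* Induction along tight sets: a proper tight set splits the problem into
   its restriction and its contraction. *)
Lemma matroid_union r1 r2 E :
  rank_like r1 -> rank_like r2 -> packable r1 r2 E -> packed r1 r2 E.
Proof.
have [n] := ubnP #|E|; elim: n r1 r2 E => // n IHn r1 r2 E ltEn R1 R2 pE.
have IH r1' r2' E' : rank_like r1' -> rank_like r2' -> #|E'| < #|E| ->
    packable r1' r2' E' -> packed r1' r2' E'.
  by move=> R1' R2' ltE'; apply: IHn => //; lia.
have [->|/set0Pn[z zE]] := eqVneq E set0.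
  by exists set0; rewrite ?sub0set ?setD0.
have [/existsP[U /and4P[sUE U0 UE tight]]|/existsPn notight] :=
  boolP [exists U : {set T}, [&& U \subset E, U != set0, U != E &
     #|E :\: U| + r1 U + r2 U <= r1 E + r2 E]].
  have pU : packable r1 r2 U.
    move=> W sWU; have := pE _ (subset_trans sWU sUE).
    by rewrite (cardsD_chain sWU sUE); lia.
  have eEU : E :\: U :|: U = E.
    apply/setP=> y; rewrite !inE.
    by case: (boolP (y \in U)) => [/(subsetP sUE)->|_]; rewrite ?orbT ?orbF.
  have pEU : packable (fun W => r1 (W :|: U)) (fun W => r2 (W :|: U)) (E :\: U).
    move=> W sW; rewrite eEU setDDl (setUC U).
    apply: pE; rewrite subUset sUE andbT.
    exact: subset_trans sW (subsetDl _ _).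
  have cU : #|U| < #|E| by apply: proper_card; rewrite properEneq UE.
  have cEU : #|E :\: U| < #|E|.
    apply: proper_card; rewrite properE subsetDl; apply: contra U0 => /subsetP sE.
    apply/eqP/setP=> y; rewrite inE; apply/negP=> yU.
    by have := sE y (subsetP sUE y yU); rewrite inE yU.
  have [F1 sF1 [e11 e12]] := IH _ _ _ R1 R2 cU pU.
  have [F2 sF2 [e21 e22]] := IH _ _ _ (rank_like_contract U R1)
    (rank_like_contract U R2) cEU pEU.
  rewrite eEU in e21 e22.
  exists (F1 :|: F2).
    rewrite subUset (subset_trans sF1 sUE).
    exact: subset_trans sF2 (subsetDl _ _).
  (* [F1] spans [U] and [F2 :|: U] spans [E], so [F1 :|: F2] spans [E] for [r1]; the complements
     combine in the same way for [r2]. *)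
  split; first by rewrite (rank_like_span _ R1 sF1 e11) setUC.
  rewrite -e22 (setUC _ U) -(rank_like_span _ R2 (subsetDl U F1) e12); congr r2.
  apply/setP=> y; rewrite !inE.
  have := subsetP sF1 y; have := subsetP sF2 y; have := subsetP sUE y; rewrite !inE.
  move=> /implyP + /implyP + /implyP.
  by case: (y \in F1) (y \in F2) (y \in U) (y \in E) => [] [] [] [].
have slack U : U \subset E -> U != set0 -> U != E ->
    r1 E + r2 E < #|E :\: U| + r1 U + r2 U.
  move=> sUE U0 UE; rewrite ltnNge; apply/negP=> tight.
  by have := notight U; rewrite /= sUE U0 UE tight.
have := pE set0 (sub0set _); rewrite setD0 => p0.
have sz : [set z] \subset E by rewrite sub1set.
have pz : r1 E + r2 E < #|E| + r1 [set z] + r2 [set z].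
  by have := pE _ sz; rewrite (cardsD1 z E) zE; lia.
have [mono1 _] := R1; have [mono2 _] := R2.
have m1 := mono1 _ _ (sub0set [set z]); have m2 := mono2 _ _ (sub0set [set z]).
(* If this inequality fails, then [r2 [set z] = r2 set0] and the empty set is tight, so [pz] gives
   the same inequality with the two ranks exchanged. *)
have [|ge2] := ltnP (r1 E + r2 E) (#|E| + r1 set0 + r2 [set z]).
  exact: packed_delete.
apply: packedC; apply: (packed_delete (z := z)) => //; first exact: packableC.
  by move=> U sUE U0 UE; have := slack U sUE U0 UE; lia.
by lia.
Qed.
End MatroidUnion.

(** * Rank of a graph *)

Section GraphRank.
Variables (T : finType) (V : {set T}) (e : rel T) (s t : T -> T).
Implicit Types (U W F : {set T}).
Hypothesis e_sym : symmetric e.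

(** Each [z] in [U] is a labelled edge from [s z] to [t z], added to the graph that [e] induces on
    [V]. *)
Definition link (U : {set T}) : rel T := fun x y =>
  [&& x \in V, y \in V & e x y] ||
  [exists z in U, (x == s z) && (y == t z) || (x == t z) && (y == s z)].

Lemma link_sym U : symmetric (link U).
Proof.
move=> x y; rewrite /link andbCA e_sym; congr (_ || _).
by apply: eq_existsb => z; rewrite orbC [(y == _) && _]andbC [(y == t z) && _]andbC.
Qed.

Lemma linkS U W : U \subset W -> subrel (link U) (link W).
Proof.
move=> sUW x y /orP[h|/existsP[z /andP[zU h]]]; apply/orP; [by left|right].
by apply/existsP; exists z; rewrite (subsetP sUW).
Qed.

Lemma link_edge U z : z \in U -> link U (s z) (t z).
Proof. by move=> zU; apply/orP; right; apply/existsP; exists z; rewrite zU !eqxx. Qed.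

Definition dif (x y : T) : 'rV[rat]_#|T| :=
  (delta_mx ord0 (enum_rank x) - delta_mx ord0 (enum_rank y))%R.

(** Row space of the oriented incidence matrix of [link U]; its dimension is the cycle matroid
    rank. *)
Definition span U : 'M[rat]_#|T| :=
  (\sum_(p : T * T | link U p.1 p.2) <<dif p.1 p.2>>)%MS.

Definition grank U := \rank (span U).

Lemma dif_span U x y : link U x y -> (dif x y <= span U)%MS.
Proof.
by move=> lxy; apply: (sumsmx_sup (x, y)) => //=; rewrite genmxE.
Qed.

Lemma spanS U W : U \subset W -> (span U <= span W)%MS.
Proof.
move=> sUW; apply/sumsmx_subP=> p /(linkS sUW) lp.
by rewrite genmxE; exact: dif_span.
Qed.

Lemma grank_like : rank_like grank.
Proof.
split=> [U W sUW|U W]; first exact/mxrankS/spanS.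
rewrite -[X in _ <= X]mxrank_sum_cap; apply: leq_add; apply: mxrankS; last first.
  by rewrite sub_capmx !spanS ?subsetIl ?subsetIr.
apply/sumsmx_subP=> p; rewrite genmxE => /orP[lp|/existsP[z /andP[+ lp]]].
  by apply: submx_trans (addsmxSl _ _); apply: dif_span; rewrite /link lp.
rewrite inE => /orP[] zU; [apply: submx_trans (addsmxSl _ _)|apply: submx_trans (addsmxSr _ _)].
all: by apply: dif_span; apply/orP; right; apply/existsP; exists z; rewrite zU.
Qed.

Lemma connect_span U x y : connect (link U) x y -> (dif x y <= span U)%MS.
Proof.
case/connectP=> p; elim: p x => [|z p IHp] x /=.
  by move=> _ ->; rewrite /dif GRing.subrr sub0mx.
case/andP=> lxz /IHp/[apply] dzy.
have -> : dif x y = (dif x z + dif z y)%R by rewrite /dif GRing.addrA GRing.subrK.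
by rewrite addmx_sub // dif_span.
Qed.

(** The indicator [phi] of the component of [x] under [link F] vanishes on [span F]. Equality of
    ranks puts [dif x y] in [span F], so [phi] agrees on [x] and [y]. *)
Lemma grank_connect F (E : {set T}) x y :
  F \subset E -> grank F = grank E -> connect (link E) x y -> connect (link F) x y.
Proof.
move=> sFE eFE /connect_span dxy.
have {}dxy : (dif x y <= span F)%MS.
  by apply: submx_trans dxy _; rewrite -(geq_leqif (mxrank_leqif_sup (spanS sFE))) -/(grank F) eFE.
pose phi : 'cV[rat]_#|T| := (\col_k (connect (link F) x (enum_val k))%:R)%R.
have dif_phi u v : (dif u v *m phi = (connect (link F) x u)%:R%:M - (connect (link F) x v)%:R%:M)%R.
  rewrite mulmxBl -!rowE; congr (_ - _)%R; apply/matrixP=> i j;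
  by rewrite !mxE enum_rankK !ord1 eqxx.
have span_phi : (span F *m phi = 0)%R.
  apply/sub_kermxP/sumsmx_subP=> -[u v] /= luv; rewrite genmxE.
  apply/sub_kermxP; rewrite dif_phi.
  have -> : connect (link F) x u = connect (link F) x v.
    by apply/idP/idP=> c; apply: connect_trans c (connect1 _); rewrite // link_sym.
  by rewrite GRing.subrr.
have : (dif x y *m phi = 0)%R.
  by case/submxP: dxy => D ->; rewrite -mulmxA span_phi mulmx0.
rewrite dif_phi connect0.
move/matrixP/(_ ord0 ord0); rewrite !mxE eqxx !GRing.mulr1n.
by case: connect => //; rewrite GRing.subr0 => /eqP; rewrite GRing.oner_eq0.
Qed.

Variables (a : T) (E : {set T}).
Hypothesis edgesV : forall z, z \in E -> s z \in V /\ t z \in V.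
Hypothesis two_entries : forall K : {set T}, K \subset V -> K != set0 -> a \notin K ->
  (forall x y, x \in K -> y \in V -> e x y -> y \in K) ->
  exists z1 z2, [/\ z1 \in E, z2 \in E, z1 != z2,
    t z1 \in K /\ s z1 \notin K & t z2 \in K /\ s z2 \notin K].

Lemma link_connected v : v \in V -> connect (link E) a v.
Proof.
move=> vV; apply/negPn/negP=> nav.
pose K := [set x in V | ~~ connect (link E) a x].
have [|||x y|z1 [_ [z1E _ _ [tK sK] _]]] := two_entries (K := K).
- by apply/subsetP=> x; rewrite inE => /andP[].
- by apply/set0Pn; exists v; rewrite inE vV.
- by rewrite inE connect0 andbF.
- rewrite !inE => /andP[xV nx] yV exy; rewrite yV; apply: contra nx => cy.
  by apply: connect_trans cy (connect1 _); rewrite /link xV yV e_sym exy.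
have [sV tV] := edgesV z1E.
move: tK sK; rewrite !inE sV tV /= negbK => /negP ntz csz; apply: ntz.
exact: connect_trans csz (connect1 (link_edge z1E)).
Qed.

(* The linked components avoiding a are each entered by two edges outside U,
   and their number bounds the rank that is still missing. *)
Lemma grank_gap U : U \subset E -> 2 * grank E <= #|E :\: U| + 2 * grank U.
Proof.
move=> sUE; have csym : connect_sym (link U) := sym_connect_sym (link_sym U).
(* [R] has one root for each component meeting [V] other than that of [a]. Joining these roots to
   the root of [a] spans everything, so at most [#|R|] dimensions are missing. *)
pose rt := root (link U); pose R := [set rt x | x in V] :\ rt a.
have spanE : (span E <= span U + \sum_(k in R) <<dif k (rt a)>>)%MS.
  have toR x : x \in V -> (dif x (rt a) <= span U + \sum_(k in R) <<dif k (rt a)>>)%MS.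
    move=> xV; have -> : dif x (rt a) = (dif x (rt x) + dif (rt x) (rt a))%R.
      by rewrite /dif GRing.addrA GRing.subrK.
    apply: addmx_sub.
      by apply: submx_trans (addsmxSl _ _); apply/connect_span/connect_root.
    have [->|rx] := eqVneq (rt x) (rt a); first by rewrite /dif GRing.subrr sub0mx.
    apply: submx_trans (addsmxSr _ _).
    by apply: (sumsmx_sup (rt x)); rewrite ?genmxE // !inE rx imset_f.
  apply/sumsmx_subP=> -[x y] /= lxy; rewrite genmxE.
  have [xV yV] : x \in V /\ y \in V.
    case/orP: lxy => [/and3P[]|/existsP[z /andP[/edgesV[sV tV]]]] //.
    by case/orP=> /andP[/eqP-> /eqP->].
  have -> : dif x y = (dif x (rt a) - dif y (rt a))%R.
    by rewrite /dif GRing.opprB GRing.addrA GRing.subrK.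
  by rewrite addmx_sub ?eqmx_opp ?toR.
have rankE : grank E <= grank U + #|R|.
  apply: leq_trans (mxrankS spanE) _; apply: leq_trans (mxrank_adds_leqif _ _) _.
  rewrite leq_add2l; apply: leq_trans (mxrank_sum_leqif _) _ => /=.
  by rewrite -[#|R|]sum1_card; apply: leq_sum => k _; rewrite mxrank_gen rank_leq_row.
suff : 2 * #|R| <= #|E :\: U| by move: rankE; lia.
(* Edges outside [U] are sorted by the component of their end [t z]; each root in [R] must receive
   two of them. *)
rewrite -!sum1_card big_distrr /= muln1.
rewrite [X in _ <= X](bigID (fun z => rt (t z) \in R)) /=; apply: leq_trans (leq_addr _ _).
rewrite [X in _ <= X](partition_big (fun z => rt (t z)) (mem R)) /=; last by move=> z /andP[].
apply: leq_sum => k; rewrite !inE => /andP[ka /imsetP[v vV ek]].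
pose K := [set x in V | rt x == k].
have [|||x y|z1 [z2 [z1E z2E z12 [tK1 sK1] [tK2 sK2]]]] := two_entries (K := K).
- by apply/subsetP=> x; rewrite inE => /andP[].
- by apply/set0Pn; exists v; rewrite inE vV ek eqxx.
- by rewrite inE eq_sym negb_and ka orbT.
- rewrite !inE => /andP[xV /eqP<-] yV exy; rewrite yV eq_sym root_connect //.
  by apply: connect1; rewrite /link xV yV exy.
have outU z : z \in E -> t z \in K -> s z \notin K -> z \notin U.
  move=> zE tK; have [sV _] := edgesV zE; apply: contra => zU.
  move: tK; rewrite !inE sV /= => /andP[_ /eqP <-]; rewrite root_connect //.
  exact: connect1 (link_edge zU).
have kR : k \in R by rewrite !inE ka ek imset_f.
rewrite sum1_card; apply/card_gt1P; exists z1, z2; split=> //.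
  rewrite unfold_in /= !inE z1E outU // -[rt (t z1) == k]andTb.
  by move: tK1; rewrite inE => /andP[_ /eqP ->]; rewrite eqxx -in_setD1 kR.
rewrite unfold_in /= !inE z2E outU //.
by move: tK2; rewrite inE => /andP[_ /eqP ->]; rewrite eqxx -in_setD1 kR.
Qed.
End GraphRank.

(** * Walk systems *)

Definition connected_in (T : finType) (e : rel T) (C : {set T}) :=
  {in C &, forall x y, connect [rel u v | [&& u \in C, v \in C & e u v]] x y}.

Definition rooted_minor (T J : finType) (e : rel T) (h : rel J) (f : J -> T) :=
  exists C : J -> {set T},
    [/\ forall v, connected_in e (C v),
        forall u v, u != v -> [disjoint C u & C v],
        forall v, f v \in C v
      & forall u v, h u v -> exists x y, [/\ x \in C u, y \in C v & e x y]].

Section Systems.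
Variables (T I : finType).
Implicit Types (e : rel T) (a b : T) (x : I -> T) (A B : I -> seq T).

Definition walks e a x A :=
  forall i, [/\ path e a (A i), last a (A i) = x i & uniq (a :: A i)].

Definition walk_system e a b x A B :=
  [/\ symmetric e, walks e a x A, walks e b x B,
      forall i j v, v \in a :: A i -> v \in b :: B j -> i = j
    & forall i, a \notin b :: B i /\ b \notin a :: A i].

Lemma walk_systemC e a b x A B :
  walk_system e a b x A B -> walk_system e b a x B A.
Proof.
case=> es wA wB dis ab; split=> // [i j v vB vA|i]; last by case: (ab i).
by apply/esym; apply: dis vA vB.
Qed.

Definition own a b A B : {set T} :=
  [set v | [exists i, v \in a :: A i] && ~~ [exists j, v \in b :: B j]].

Definition crossings x A B : {set T} :=
  [set z | [exists i, [&& z \in A i, z \in B i & z != x i]]].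

Lemma notin_own a b A B j v : v \in b :: B j -> v \notin own a b A B.
Proof.
by move=> vB; apply/negP; rewrite in_set => /andP[_ /existsP[]]; exists j.
Qed.

(** Prepending [a] shifts the index by one, so this is the predecessor of [z] on [A i]. In a walk
    system the index [i] is unique; where there is none, the value is [z] itself. *)
Definition before a A B z :=
  if [pick i | (z \in A i) && (z \in B i)] is Some i
  then nth z (a :: A i) (index z (A i)) else z.

Definition after A B z :=
  if [pick i | (z \in A i) && (z \in B i)] is Some i
  then nth z (A i) (index z (A i)).+1 else z.

Definition alternating a A B :=
  forall i, path (fun z z' => ~~ ((z \in B i) && (z' \in B i))) a (A i).

Definition multiple A B :=
  forall i v, v \in A i -> v \notin B i -> exists2 j, j != i & v \in A j.

Lemma walk_end_in e a b x A B i : walk_system e a b x A B -> x i \in A i /\ x i \in B i.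
Proof.
case=> _ wA wB _ ab; have [_ lA _] := wA i; have [_ lB _] := wB i.
have [na nb] := ab i.
have xA : x i \in a :: A i by rewrite -lA mem_last.
have xB : x i \in b :: B i by rewrite -lB mem_last.
split; first by move: xA; rewrite inE => /orP[/eqP xa|//]; rewrite -xa xB in na.
by move: xB; rewrite inE => /orP[/eqP xb|//]; rewrite -xb xA in nb.
Qed.

Lemma crossing_neq e a b x A B i z :
    walk_system e a b x A B -> z \in A i -> z \in B i ->
  [/\ z != a, z != b & z != x i -> forall j, z != x j].
Proof.
move=> sys zA zB; have [_ _ _ dis /(_ i)[na nb]] := sys; split.
- by apply: contraNneq na => <-; rewrite inE zB orbT.
- by apply: contraNneq nb => <-; rewrite inE zA orbT.
move=> zx j; apply: contra_neq zx => zxj; have [_ xB] := walk_end_in j sys.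
have -> : i = j by apply: (dis _ _ z); rewrite inE ?zA // zxj ?xB orbT.
by [].
Qed.

Lemma not_last e a x A i p1 z z' p2 :
  walks e a x A -> A i = p1 ++ z :: z' :: p2 -> z != x i.
Proof.
move=> wA Ai; have [_ lA] := wA i; rewrite Ai -cat_cons cat_uniq => /and3P[_ _ /andP[zp2 _]].
by rewrite -lA Ai last_cat /=; apply: contraNneq zp2 => ->; exact: mem_last.
Qed.

(** * Crossings of alternating walk systems *)

Section Reduced.
Variables (e : rel T) (a b : T) (x : I -> T) (A B : I -> seq T).
Hypothesis sysAB : walk_system e a b x A B.

Lemma walk_pathP i k c : k < size (A i) -> e (nth c (a :: A i) k) (nth c (A i) k).
Proof. by case: sysAB => _ /(_ i)[/(pathP c) pA _ _] _ _ _; apply: pA. Qed.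

Lemma pick_layer z i :
  z \in A i -> z \in B i -> [pick j | (z \in A j) && (z \in B j)] = Some i.
Proof.
move=> zA zB; case: pickP => [j /andP[zA' zB']|/(_ i)]; last by rewrite zA zB.
by case: sysAB => _ _ _ dis _; congr Some; apply: (dis _ _ z); rewrite inE ?zA' ?zB orbT.
Qed.

Lemma mem_own i v : v \in a :: A i -> v \notin b :: B i -> v \in own a b A B.
Proof.
case: sysAB => _ _ _ dis _ vA vB; rewrite inE; apply/andP; split.
  by apply/existsP; exists i.
apply/negP=> /existsP[j vBj]; move: vB.
by rewrite (dis _ _ _ vA vBj) vBj.
Qed.

Lemma b_notinA i : b \notin A i.
Proof. by case: sysAB => _ _ _ _ /(_ i)[_]; rewrite inE negb_or => /andP[]. Qed.

Lemma index_crossing z i : z \in A i -> z != x i -> (index z (A i)).+1 < size (A i).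
Proof.
case: sysAB => _ /(_ i)[_ lA _] _ _ _ zA zx.
rewrite ltnNge; apply: contraNN zx => le; rewrite -lA.
have sz := zA; rewrite -index_mem in sz.
have ek : index z (A i) = (size (A i)).-1.
  by move: le sz; set k := index _ _; set n := size _; lia.
have := nth_last a (A i); rewrite -ek nth_index // => ->.
by case: (A i) zA.
Qed.

Hypothesis altA : alternating a A B.

Lemma alternatingP i k c : k < size (A i) ->
  ~~ ((nth c (a :: A i) k \in B i) && (nth c (A i) k \in B i)).
Proof. by move=> lt; have /(pathP c)/(_ k lt) := altA i. Qed.

(** Alternation keeps both neighbours of [z] on [A i] off [B i], and disjointness keeps them off the
    other B-walks. The successor exists because [z] is not the end [x i]. *)
Lemma before_after z : z \in crossings x A B ->
  [/\ before a A B z \in own a b A B, after A B z \in own a b A B,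
      e (before a A B z) z & e z (after A B z)].
Proof.
rewrite inE => /existsP[i /and3P[zA zB zx]].
rewrite /before /after (pick_layer zA zB).
have lt1 := index_crossing zA zx; set k := index z (A i) in lt1 *.
have ek : nth z (A i) k = z by rewrite nth_index.
have e1 := walk_pathP z (ltnW lt1); have e2 := walk_pathP z lt1.
have a1 := alternatingP z (ltnW lt1); have a2 := alternatingP z lt1.
rewrite ek zB andbT in a1 e1; rewrite /= ek zB in a2 e2.
split=> //; apply: (@mem_own i).
- by apply: mem_nth; exact: (ltnW (ltnW lt1)).
- rewrite inE negb_or a1 andbT.
  case: k lt1 {ek e1 e2 a1 a2} => [|k] lt1 /=.
    by case: sysAB => _ _ _ _ /(_ i)[]; rewrite !inE !negb_or => /andP[].
  apply: contraNneq (b_notinA i) => <-; apply: mem_nth; exact: (ltnW (ltnW lt1)).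
- by rewrite inE mem_nth ?orbT.
- rewrite inE negb_or a2 andbT.
  by apply: contraNneq (b_notinA i) => <-; apply: mem_nth.
Qed.

(** Take the first vertex of [A i] in [K] and its predecessor [u]. As [K] is closed, [u] is not
    A-only, so it is a crossing; the vertex before [u] is outside [K] by minimality. *)
Lemma first_entry (K : {set T}) i v :
    K \subset own a b A B -> a \notin K -> v \in K -> v \in A i ->
    (forall u v, u \in K -> v \in own a b A B -> e u v -> v \in K) ->
  exists z, [/\ z \in crossings x A B, z \in A i, z \in B i,
                after A B z \in K & before a A B z \notin K].
Proof.
move=> sK aK vK vA closed.
have [es wA _ dis ab] := sysAB; have [_ lA uA'] := wA i.
have hasK : has (mem K) (A i) by apply/hasP; exists v.
pose k := find (mem K) (A i); have ltk : k < size (A i) by rewrite -has_find.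
have kK : nth a (A i) k \in K by exact: (nth_find a hasK).
have beforeK m : m < k.+1 -> nth a (a :: A i) m \notin K.
  by case: m => [//|m] /= ltm; have /= -> := before_find a ltm.
have := walk_pathP a ltk; set u := nth a (a :: A i) k => euk.
have uK : u \notin K by exact: beforeK.
have uA : u \in a :: A i by apply: mem_nth; exact: ltnW.
have uV : u \notin own a b A B by apply: contra uK => uV; apply: closed kK uV _; rewrite es.
have aV : a \in own a b A B by apply: (@mem_own i); rewrite ?mem_head //; case: (ab i).
(* [u] is not [a], which is A-only, so [u] has a position [m = k.-1] in the list [A i]. *)
have [k0|/prednK] := posnP k; first by move: uV; rewrite /u k0 /= aV.
move: (k.-1) => m km; rewrite -km in ltk kK beforeK.
have ek : u = nth a (A i) m by rewrite /u -km.
have uAi : u \in A i by rewrite ek mem_nth // ltnW.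
have uB : u \in B i.
  apply: contraNT uV => uB; apply: (@mem_own i) => //.
  by rewrite inE negb_or uB andbT; apply: contraNneq (b_notinA i) => <-.
have uAi1 : uniq (A i) by case/andP: uA'.
have iu : index u (A i) = m by rewrite ek index_uniq // ltnW.
exists u; rewrite /before /after (pick_layer uAi uB) iu uAi uB.
rewrite !(set_nth_default a) //= ?ltnS; try exact: ltnW; try exact: (ltnW (ltnW _)).
split=> //; last exact: beforeK.
rewrite inE; apply/existsP; exists i; rewrite uAi uB /=.
apply/eqP=> ux; move: iu; rewrite ux -lA.
have -> : last a (A i) = nth a (A i) (size (A i)).-1 by rewrite nth_last.
rewrite index_uniq //; last by case: (A i) ltk.
by move=> em; move: ltk; rewrite -em; case: (A i) => //= y l; rewrite ltnn.
Qed.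

Hypothesis mulA : multiple A B.

(** A vertex of [K] lies on two A-walks, and each enters [K] at a crossing. These differ because a
    crossing lies on [A i] and [B i] for a single [i]. *)
Lemma two_entries (K : {set T}) :
    K \subset own a b A B -> K != set0 -> a \notin K ->
    (forall u v, u \in K -> v \in own a b A B -> e u v -> v \in K) ->
  exists z1 z2, [/\ z1 \in crossings x A B, z2 \in crossings x A B, z1 != z2,
    after A B z1 \in K /\ before a A B z1 \notin K
    & after A B z2 \in K /\ before a A B z2 \notin K].
Proof.
move=> sK /set0Pn[v vK] aK closed; have [_ _ _ dis _] := sysAB.
have := subsetP sK v vK; rewrite inE => /andP[/existsP[i viA] /existsPn vB].
have vA : v \in A i.
  by move: viA; rewrite inE => /orP[/eqP va|//]; rewrite -va vK in aK.
have [|j ji vAj] := mulA vA; first by apply: contraNN (vB i); rewrite inE orbC => ->.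
have [z1 [z1E z1A z1B tK1 sK1]] := first_entry sK aK vK vA closed.
have [z2 [z2E z2A z2B tK2 sK2]] := first_entry sK aK vK vAj closed.
exists z1, z2; split=> //; apply: contraNneq ji => z12.
by apply/eqP; apply: (dis _ _ z1); rewrite inE ?z1B ?z12 ?z2A orbT.
Qed.

(** Each link labelled by [z] in [F] is realised by the path through [z] between its two
    neighbours. *)
Lemma own_connected (F : {set T}) :
    F \subset crossings x A B ->
    (forall v, v \in own a b A B ->
       connect (link (own a b A B) e (before a A B) (after A B) F) a v) ->
  connected_in e (own a b A B :|: F).
Proof.
move=> sF conn; set C := _ :|: F; have [es _ _ _ _] := sysAB.
pose ind := [rel u v | [&& u \in C, v \in C & e u v]].
have ind_sym : connect_sym ind.
  by apply: sym_connect_sym => u v; rewrite /= es andbCA.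
have ownC u : u \in own a b A B -> u \in C by move=> uo; rewrite in_setU uo.
have FC u : u \in F -> u \in C by move=> uF; rewrite in_setU uF orbT.
have edgeC z : z \in F -> [/\ connect ind (before a A B z) z & connect ind z (after A B z)].
  move=> zF; have [bo ao eb ea] := before_after (subsetP sF z zF).
  by split; apply: connect1; rewrite /= (FC z zF) ?(ownC _ bo) ?(ownC _ ao) ?eb ?ea.
have link_ind : subrel (link (own a b A B) e (before a A B) (after A B) F) (connect ind).
  move=> u v /orP[/and3P[uo vo euv]|/existsP[z /andP[/edgeC[c1 c2]]]].
    by apply: connect1; rewrite /= !ownC.
  have c12 := connect_trans c1 c2.
  by case/orP=> /andP[/eqP-> /eqP->]; rewrite // ind_sym.
have from_a u : u \in C -> connect ind a u.
  rewrite in_setU => /orP[/conn|uF]; first exact: connect_sub.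
  have [bo _ _ _] := before_after (subsetP sF u uF).
  by apply: connect_trans (connect_sub link_ind (conn _ bo)) _; case: (edgeC _ uF).
by move=> u v /from_a cu /from_a cv; apply: connect_trans cv; rewrite ind_sym.
Qed.

End Reduced.

(** The hub [inl true] stands for [a] and [inl false] for [b]; the flag [q] chooses between the
    patterns [K_{1,1,I}] and [K_{2,I}]. *)
Definition hub_rel (q : bool) : rel (bool + I) := fun u v =>
  match u, v with
  | inl c, inl c' => q && (c != c')
  | inr _, inr _ => false
  | _, _ => true
  end.

Definition hub_root a b x (u : bool + I) : T :=
  match u with inl true => a | inl false => b | inr i => x i end.

Lemma crossingsC x A B : crossings x B A = crossings x A B.
Proof. by apply/setP=> z; rewrite !inE; apply: eq_existsb => i; rewrite andbCA. Qed.

(** [x i] lies on [B i], so by alternation the vertex before it on [A i] does not. *)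
Lemma last_own e a b x A B i :
    walk_system e a b x A B -> alternating a A B ->
  exists2 u, u \in own a b A B & e u (x i).
Proof.
move=> sysAB altA; have [_ wA wB _ ab] := sysAB; have [pA lA _] := wA i.
have [na nb] := ab i.
have [_ xB] := walk_end_in i sysAB.
case/lastP eA : (A i) => [|p y].
  by move: lA na; rewrite eA /= => ->; rewrite inE xB orbT.
have ey : y = x i by rewrite -lA eA last_rcons.
have := altA i; rewrite eA rcons_path ey xB andbT => /andP[_ uB].
move: pA; rewrite eA rcons_path ey => /andP[_ eu].
exists (last a p) => //; apply: (mem_own sysAB (i := i)).
  by rewrite eA -cats1 -cat_cons mem_cat mem_last.
rewrite inE negb_or uB andbT; apply: contraNneq nb => <-.
by rewrite eA -cats1 -cat_cons mem_cat mem_last.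
Qed.

Lemma alternating_minor e a b x A B w (q : bool) :
    walk_system e a b x A B ->
    alternating a A B -> alternating b B A -> multiple A B -> multiple B A ->
    w \in own b a B A -> (q -> e a w) ->
  rooted_minor e (hub_rel q) (hub_root a b x).
Proof.
move=> sysAB altA altB mulA mulB wB aw.
have sysBA := walk_systemC sysAB; have [es wlkA wlkB dis ab] := sysAB.
set E := crossings x A B.
have edgesA z : z \in E -> before a A B z \in own a b A B /\ after A B z \in own a b A B.
  by case/(before_after sysAB altA).
have edgesB z : z \in E -> before b B A z \in own b a B A /\ after B A z \in own b a B A.
  by rewrite /E -crossingsC => /(before_after sysBA altB)[].
have twoA := two_entries sysAB mulA.
have twoB := two_entries sysBA mulB; rewrite crossingsC -/E in twoB.
pose rA := grank (own a b A B) e (before a A B) (after A B).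
pose rB := grank (own b a B A) e (before b B A) (after B A).
have [F sF [eA eB]] : packed rA rB E.
  apply: matroid_union; [exact: grank_like|exact: grank_like|].
  (* The two rank gaps, added and halved, are the packing condition. *)
  move=> U sU; have := grank_gap es edgesA twoA sU; have := grank_gap es edgesB twoB sU.
  rewrite -/(rA _) -/(rB _) -/(rA _) -/(rB _); lia.
have sF' : E :\: F \subset E by exact: subsetDl.
pose CA := own a b A B :|: F; pose CB := own b a B A :|: (E :\: F).
have cA : connected_in e CA.
  apply: (own_connected sysAB altA sF) => v vV.
  by apply: (grank_connect es sF eA); apply: link_connected vV.
have cB : connected_in e CB.
  apply: (own_connected sysBA altB); first by rewrite crossingsC.
  move=> v vV; apply: (grank_connect es sF' eB); exact: link_connected vV.
have xAB i := walk_end_in i sysAB.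
have xinj i j : x i = x j -> i = j.
  move=> xij; apply: (dis _ _ (x i)); first by rewrite inE (xAB i).1 orbT.
  by rewrite xij inE (xAB j).2 orbT.
have xE i : x i \notin E.
  rewrite inE; apply/existsP=> -[j /and3P[_ xjB]].
  have -> : i = j by apply: (dis _ _ (x i)); rewrite inE ?(xAB i).1 ?xjB orbT.
  by rewrite eqxx.
have xnotA i : x i \notin CA.
  rewrite in_setU negb_or (contra (subsetP sF _) (xE i)) andbT.
  by apply: (@notin_own _ _ _ _ i); rewrite inE (xAB i).2 orbT.
have xnotB i : x i \notin CB.
  rewrite in_setU negb_or (contra (subsetP sF' _) (xE i)) andbT.
  by apply: (@notin_own _ _ _ _ i); rewrite inE (xAB i).1 orbT.
have dAB : [disjoint CA & CB].
  have ownE u : u \in E -> (u \notin own a b A B) /\ (u \notin own b a B A).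
    rewrite in_set => /existsP[i /and3P[uA uB _]].
    by split; apply: (@notin_own _ _ _ _ i); rewrite inE ?uA ?uB orbT.
  rewrite disjoints_subset; apply/subsetP=> u; rewrite in_setC /CA /CB !in_setU !negb_or.
  rewrite in_setD => /orP[uo|uF]; apply/andP; split.
  - by move: uo; rewrite !inE => /andP[-> _]; rewrite andbF.
  - by apply/negP=> /andP[_ /ownE[]]; rewrite uo.
  - by case: (ownE u (subsetP sF u uF)).
  - by rewrite uF.
have [i0 aA] : exists i0 : I, a \in own a b A B.
  move: wB; rewrite inE => /andP[/existsP[i _] _]; exists i.
  by apply: (mem_own sysAB (i := i)); [exact: mem_head|case: (ab i)].
have bB : b \in own b a B A.
  by apply: (mem_own sysBA (i := i0)); [exact: mem_head|case: (ab i0)].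
pose C (u : bool + I) :=
  match u with inl true => CA | inl false => CB | inr i => [set x i] end.
have toA i : exists2 u, u \in CA & e u (x i).
  by have [u uo eu] := last_own i sysAB altA; exists u; rewrite // in_setU uo.
have toB i : exists2 u, u \in CB & e u (x i).
  by have [u uo eu] := last_own i sysBA altB; exists u; rewrite // in_setU uo.
exists C; split.
- case=> [[] //|i] u v /set1P-> /set1P->; exact: connect0.
- case=> [[]|i] [[]|j] //= uv.
  + by rewrite disjoint_sym disjoints1.
  + by rewrite disjoint_sym.
  + by rewrite disjoint_sym disjoints1.
  + by rewrite disjoints1.
  + by rewrite disjoints1.
  + by rewrite disjoints1 in_set1; apply: contra_neqN uv => /eqP/xinj->.
- by case=> [[]|i] /=; rewrite ?in_set1 // in_setU ?aA ?bB.
- have aw' : q -> exists y z, [/\ y \in CA, z \in CB & e y z].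
    by move=> /aw eaw; exists a, w; rewrite !in_setU aA wB.
  case=> [[]|i] [[]|j] //=; rewrite ?andbF ?andbT //.
  + by have [u uC eu] := toA j => _; exists u, (x j); rewrite in_set1.
  + by move=> /aw'[y [z [yA zB eyz]]]; exists z, y; rewrite es.
  + by have [u uC eu] := toB j => _; exists u, (x j); rewrite in_set1.
  + by have [u uC eu] := toA i => _; exists (x i), u; rewrite in_set1 es.
  + by have [u uC eu] := toB i => _; exists (x i), u; rewrite in_set1 es.
Qed.

End Systems.

(** * Contraction of an edge *)

Section Contraction.
Variables (T : finType) (e : rel T) (u y : T).
Hypothesis es : symmetric e.

Definition merge (v : T) := if v == u then y else v.

(** The vertex type stays [T]: for [y != u] the vertex [u] becomes isolated, and the contracted edge
    leaves a loop at [y]. *)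
Definition contract : rel T := fun p q =>
  [exists p', exists q', [&& merge p' == p, merge q' == q & e p' q']].

Lemma merge_id v : v != u -> merge v = v.
Proof. by rewrite /merge => /negPf->. Qed.

Lemma contract_merge p q : e p q -> contract (merge p) (merge q).
Proof.
by move=> epq; apply/existsP; exists p; apply/existsP; exists q; rewrite !eqxx.
Qed.

Lemma contract_sym : symmetric contract.
Proof.
suff imp p q : contract p q -> contract q p by move=> p q; apply/idP/idP; exact: imp.
case/existsP=> p' /existsP[q' /and3P[/eqP<- /eqP<- epq]].
by apply: contract_merge; rewrite es.
Qed.

Lemma contract_keep p q : p != u -> q != u -> e p q -> contract p q.
Proof. by move=> pu qu /contract_merge; rewrite !merge_id. Qed.

Lemma contract_from q : q != u -> e u q -> contract y q.
Proof. by move=> qu /contract_merge; rewrite (merge_id qu) /merge eqxx. Qed.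

Lemma contract_to p : p != u -> e p u -> contract p y.
Proof. by move=> pu /contract_merge; rewrite (merge_id pu) /merge eqxx. Qed.

Lemma path_contract p s : u \notin p :: s -> path e p s -> path contract p s.
Proof.
elim: s p => //= q s IHs p; rewrite inE negb_or eq_sym => /andP[pu us] /andP[epq pqs].
rewrite contract_keep ?IHs //.
by move: us; rewrite inE negb_or eq_sym => /andP[].
Qed.

(** Bags are pulled back along [merge]; its only fibre with two vertices is joined by the edge from
    [u] to [y]. *)
Lemma rooted_minor_contract (J : finType) (h : rel J) (f : J -> T) :
  e u y -> (forall v, f v != u) -> rooted_minor contract h f -> rooted_minor e h f.
Proof.
move=> euy fu [C [conn dis root touch]].
exists (fun v => [set p | merge p \in C v]); split.
- move=> v p q; rewrite !inE => pC qC.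
  set D := [set p | merge p \in C v].
  have fiber p1 p2 : merge p1 \in C v -> merge p1 = merge p2 ->
      connect [rel s t | [&& s \in D, t \in D & e s t]] p1 p2.
    move=> p1C p12; have p2C : merge p2 \in C v by rewrite -p12.
    have [->|ne] := eqVneq p1 p2; first exact: connect0.
    apply: connect1; rewrite /= !inE p1C p2C /=; move: p12 ne; rewrite /merge.
    case: (eqVneq p1 u) => [->|_]; case: (eqVneq p2 u) => [->|_] //.
    + by move=> <-.
    + by move=> ->; rewrite es.
    + by move=> ->; rewrite eqxx.
  case/connectP: (conn v _ _ pC qC) => s.
  elim: s p pC => [|r s IHs] p pC /=; first by move=> _ /esym; exact: fiber.
  case/andP=> /and3P[_ rC /existsP[p' /existsP[r' /and3P[/eqP p'E /eqP r'E e']]]].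
  rewrite -r'E in rC *.
  move=> ps qE; apply: connect_trans (IHs _ rC ps qE).
  apply: connect_trans (fiber _ _ pC (esym p'E)) (connect1 _).
  by rewrite /= !inE p'E pC rC.
- move=> v w /dis; rewrite !disjoints_subset => /subsetP s.
  by apply/subsetP=> p; rewrite !inE => /s; rewrite inE.
- by move=> v; rewrite inE merge_id.
- move=> v w /touch[p [q [pC qC /existsP[p' /existsP[q' /and3P[/eqP p'E /eqP q'E e']]]]]].
  by exists p', q'; rewrite !inE p'E q'E.
Qed.

End Contraction.

(** * Contractions applied to walk systems *)

Section Steps.
Variables (T I : finType).
Implicit Types (e : rel T) (a b w u y z : T) (x : I -> T) (A B : I -> seq T) (i j : I).

Definition upd A i s := fun j => if j == i then s else A j.

Lemma upd_sub A i s : {subset s <= A i} -> forall j, {subset upd A i s j <= A j}.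
Proof. by move=> sub j; rewrite /upd; case: eqP => [->|_]. Qed.

Lemma walk_system_sub e e' a b x A A' B B' :
    walk_system e a b x A B -> symmetric e' -> walks e' a x A' -> walks e' b x B' ->
    (forall i, {subset A' i <= A i}) -> (forall i, {subset B' i <= B i}) ->
  walk_system e' a b x A' B'.
Proof.
case=> _ _ _ dis ab es wA wB sA sB; split=> // [i j v vA vB|i].
  apply: (dis i j v); rewrite inE; [move: vA|move: vB]; rewrite inE.
    by case/orP=> [->//|/sA->]; rewrite orbT.
  by case/orP=> [->//|/sB->]; rewrite orbT.
have [na nb] := ab i; split; [apply: contra na|apply: contra nb]; rewrite !inE.
  by case/orP=> [->//|/sB->]; rewrite orbT.
by case/orP=> [->//|/sA->]; rewrite orbT.
Qed.

Lemma walks_contract e a x A u y :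
  (forall i, u \notin a :: A i) -> walks e a x A -> walks (contract e u y) a x A.
Proof. by move=> nu wA i; have [pA lA uA] := wA i; split=> //; apply: path_contract. Qed.

Lemma walks_upd e a x A i s :
    (forall j, j != i -> [/\ path e a (A j), last a (A j) = x j & uniq (a :: A j)]) ->
    [/\ path e a s, last a s = x i & uniq (a :: s)] ->
  walks e a x (upd A i s).
Proof. by move=> wA ws j; rewrite /upd; case: eqP => [->|/eqP/wA]. Qed.

Lemma walks_skip e a x A i u y p1 m c p2 :
    walks e a x A -> A i = p1 ++ m ++ c :: p2 -> (forall j, j != i -> u \notin a :: A j) ->
    u \notin a :: p1 -> u \notin c :: p2 -> contract e u y (last a p1) c ->
  walks (contract e u y) a x (upd A i (p1 ++ c :: p2)).
Proof.
move=> wA Ai uA up1 up2 elc; apply: walks_upd => [j ji|].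
  by have [pj lj uj] := wA j; split=> //; apply: path_contract => //; exact: uA.
have [pA lA] := wA i; rewrite Ai => uniqA; split.
- move: pA; rewrite Ai !cat_path /= elc => /and3P[pp1 _ /andP[_ pp2]].
  by rewrite !path_contract.
- by move: lA; rewrite Ai !last_cat.
- apply: subseq_uniq uniqA; rewrite /= eqxx; apply: cat_subseq => //.
  exact: suffix_subseq.
Qed.

Lemma in_split (v : T) s : v \in s -> exists s1 s2, s = s1 ++ v :: s2.
Proof. by case/splitPr=> s1 s2; exists s1, s2. Qed.

Lemma mem_skip (p m q : seq T) : {subset p ++ q <= p ++ m ++ q}.
Proof. by move=> v; rewrite !mem_cat => /orP[->|->]; rewrite ?orbT. Qed.

(** Only [A i] passes through [u], so contracting [u] into either neighbour just shortens that
    walk. *)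
Lemma remove_single e a b x A B i u y p1 c p2 :
    walk_system e a b x A B -> A i = p1 ++ u :: c :: p2 ->
    u \notin B i -> (forall j, j != i -> u \notin A j) ->
    y = last a p1 \/ y = c ->
  walk_system (contract e u y) a b x (upd A i (p1 ++ c :: p2)) B.
Proof.
move=> sys Ai uB uA yE; have [es wA wB dis ab] := sys.
have [pA _ uniqA] := wA i.
have uAi : u \in A i by rewrite Ai mem_cat inE eqxx orbT.
have ua : u != a by apply: contraTneq uAi => ->; case/andP: uniqA.
have nuB j : u \notin b :: B j.
  apply/negP=> uBj; have ij : i = j by apply: (dis _ _ u); rewrite // inE uAi orbT.
  move: uBj; rewrite -ij inE (negPf uB) orbF => /eqP ub.
  by have [_] := ab i; rewrite -ub inE uAi orbT.
move: uniqA pA; rewrite Ai -cat_cons cat_uniq cat_path.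
case/and3P=> _ /hasPn up /andP[ucp _] /and4P[_ elu euc _].
have up1 : u \notin a :: p1 by apply: up; exact: mem_head.
apply: (walk_system_sub sys) => [|||j|j v //]; first exact: contract_sym.
- apply: (walks_skip (m := [:: u]) wA Ai) => //.
    by move=> j /uA uAj; rewrite inE negb_or ua.
  case: yE => ->.
    apply: contract_from => //; rewrite eq_sym.
    by move: ucp; rewrite inE negb_or => /andP[].
  by apply: contract_to => //; apply: contraNneq up1 => <-; exact: mem_last.
- exact: walks_contract.
- by apply: upd_sub => v; rewrite Ai => /(mem_skip [:: u]).
Qed.

(** On [A i] only [z] disappears. On [B i] the vertices [z] and [z'] may be far apart; the segment
    between them becomes a closed detour and is cut out. *)
Lemma merge_crossing e a b x A B i z z' p1 p2 :
    walk_system e a b x A B -> A i = p1 ++ z :: z' :: p2 -> z \in B i -> z' \in B i ->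
  exists s : seq T, [/\ {subset s <= B i}, size s <= size (B i)
    & walk_system (contract e z z') a b x (upd A i (p1 ++ z' :: p2)) (upd B i s)].
Proof.
move=> sys Ai zB z'B; have [es wA wB dis ab] := sys.
have [pA lA uniqA] := wA i; have [pB lB uniqB] := wB i.
have zA : z \in A i by rewrite Ai mem_cat inE eqxx orbT.
have zz' : z != z'.
  move: uniqA; rewrite Ai -cat_cons cat_uniq => /and3P[_ _ /=].
  by rewrite inE negb_or => /and3P[/andP[]].
have [za zb _] := crossing_neq sys zA zB.
have nzA j : j != i -> z \notin a :: A j.
  move=> ji; rewrite inE negb_or za; apply: contraNN ji => zAj.
  by apply/eqP; apply: (dis _ _ z); rewrite inE ?zAj ?zB orbT.
have nzB j : j != i -> z \notin b :: B j.
  move=> ji; rewrite inE negb_or zb; apply: contraNN ji => zBj.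
  by apply/eqP/esym; apply: (dis _ _ z); rewrite inE ?zBj ?zA orbT.
have zp2 : z \notin z' :: p2.
  by move: uniqA; rewrite Ai -cat_cons cat_uniq => /and3P[_ _ /andP[]].
have wA' : walks (contract e z z') a x (upd A i (p1 ++ z' :: p2)).
  move: uniqA pA; rewrite Ai -cat_cons cat_uniq cat_path.
  case/and3P=> _ /hasPn up _ /and3P[_ elz _].
  have up1 : z \notin a :: p1 by apply: up; exact: mem_head.
  apply: (walks_skip (m := [:: z]) wA Ai) => //.
  by apply: contract_to => //; apply: contraNneq up1 => <-; exact: mem_last.
have zx := not_last wA Ai.
have finish q1 m c q2 : B i = q1 ++ m ++ c :: q2 -> z \notin b :: q1 -> z \notin c :: q2 ->
    contract e z z' (last b q1) c ->
  exists s : seq T, [/\ {subset s <= B i}, size s <= size (B i)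
    & walk_system (contract e z z') a b x (upd A i (p1 ++ z' :: p2)) (upd B i s)].
  move=> Bi zq1 zq2 elc; have sub : {subset q1 ++ c :: q2 <= B i}.
    by rewrite Bi; exact: mem_skip.
  exists (q1 ++ c :: q2); split=> //.
    by rewrite Bi !size_cat leq_add2l leq_addl.
  apply: (walk_system_sub sys) wA' _ _ _; first exact: contract_sym.
  - exact: (walks_skip wB Bi).
  - by apply: upd_sub => v; rewrite Ai => /(mem_skip [:: z]).
  - exact: upd_sub.
have [q1 [q Bi]] := in_split zB.
move: uniqB pB lB z'B; rewrite Bi -cat_cons cat_uniq cat_path last_cat mem_cat inE eq_sym.
rewrite (negPf zz') /= => /and3P[_ /norP[zq1 _] /andP[zq _]].
move=> /and3P[_ elz ezq] lq /orP[/in_split[r1 [r2 q1E]]|/in_split[r1 [r2 qE]]]; rewrite -Bi.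
(* [z'] precedes [z]: the walk goes from [z'] to the successor [d] of [z], which exists because [z]
   is not [x i]. *)
- case: q => [|d q] in Bi zq ezq lq *; first by rewrite -lq eqxx in zx.
  move: zq ezq => /= zq /andP[ezd _]; rewrite inE negb_or in zq.
  apply: (finish (rcons r1 z') (rcons r2 z) d q).
  + by rewrite Bi q1E -!cats1 -!catA.
  + apply: contra zq1; rewrite q1E !inE mem_rcons mem_cat !inE.
    by case/or3P=> ->; rewrite ?orbT.
  + by rewrite inE negb_or.
  + rewrite last_rcons; apply: contract_from => //; by case/andP: zq; rewrite eq_sym.
- apply: (finish q1 (z :: r1) z' r2) => //; first by rewrite Bi qE.
    by apply: contra zq; rewrite qE mem_cat => ->; rewrite orbT.
  by apply: contract_to => //; apply: contraNneq zq1 => <-; exact: mem_last.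
Qed.

(** Several A-walks may pass through [u]; each of them now leaves [a] at the vertex after [u]. *)
Lemma absorb_hub e a b x A B u :
    walk_system e a b x A B -> u != a -> e a u -> (forall j, u \notin b :: B j) ->
  walk_system (contract e u a) a b x
    (fun j => if u \in A j then drop (index u (A j)).+1 (A j) else A j) B.
Proof.
move=> sys ua eau uB; have [es wA wB dis ab] := sys.
have sub j : {subset (if u \in A j then drop (index u (A j)).+1 (A j) else A j) <= A j}.
  by move=> v; case: ifP => // _; exact: mem_drop.
apply: (walk_system_sub sys) => [||||j v //]; last exact: sub.
- exact: contract_sym.
2: exact: walks_contract.
move=> j; have [pA lA uniqA] := wA j; case: ifPn => [uAj|uAj]; last first.
  by split=> //; apply: path_contract; rewrite // inE negb_or ua.
have [_ xB] := walk_end_in j sys.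
have [p1 [p2 Aj]] := in_split uAj; have up1 : u \notin p1.
  by move: uniqA; rewrite Aj -cat_cons cat_uniq => /and3P[_ /= /norP[/norP[]]].
have -> : drop (index u (A j)).+1 (A j) = p2.
  by rewrite Aj index_cat (negPf up1) /= eqxx addn0 -cat_rcons drop_size_cat // size_rcons.
move: uniqA pA lA; rewrite Aj /= mem_cat cat_uniq cat_path last_cat inE /= !negb_or.
case/and5P=> /and3P[_ _ ap2] _ /andP[_ _] up2 uniq2 /and3P[_ _ pu] lu.
(* If nothing followed [u], it would be [x j], a vertex of [B j]. *)
case: p2 => [|c p2] in Aj ap2 up2 uniq2 pu lu *.
  by have := uB j; rewrite inE negb_or [u]lu xB andbF.
move: pu up2 => /= /andP[euc pc] /norP[uc up2]; split=> //.
  rewrite path_contract ?inE ?negb_or ?uc // andbT.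
  by apply: contract_from => //; rewrite eq_sym.
by rewrite ap2.
Qed.

End Steps.

(** * Reduction of walk systems *)

Section Reduction.
Variables (T I : finType) (q : bool).
Implicit Types (e : rel T) (a b w u y z : T) (x : I -> T) (A B : I -> seq T) (i j : I).

Definition length_sum A := \sum_i size (A i).

Lemma length_sum_lt A A' i :
  (forall j, size (A' j) <= size (A j)) -> size (A' i) < size (A i) ->
  length_sum A' < length_sum A.
Proof.
move=> le lt; rewrite /length_sum (bigD1 i) //= [ltnRHS](bigD1 i) //=.
by rewrite -addSn leq_add // leq_sum.
Qed.

Lemma length_sum_le A A' :
  (forall j, size (A' j) <= size (A j)) -> length_sum A' <= length_sum A.
Proof. by move=> le; apply: leq_sum => i _. Qed.

Lemma length_sum_upd_lt A i (s : seq T) :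
  size s < size (A i) -> length_sum (upd A i s) < length_sum A.
Proof.
move=> lt; apply: (@length_sum_lt _ _ i) => [j|]; rewrite /upd ?eqxx //.
by case: eqP => [->|//]; exact: ltnW.
Qed.

Lemma length_sum_upd_le A i (s : seq T) :
  size s <= size (A i) -> length_sum (upd A i s) <= length_sum A.
Proof. by move=> le; apply: length_sum_le => j; rewrite /upd; case: eqP => [->|]. Qed.

Lemma own_sub a b A A' B B' i v :
    v \in own b a B A -> (forall i, {subset A' i <= A i}) -> v \in b :: B' i ->
  v \in own b a B' A'.
Proof.
rewrite !inE => /andP[_ /existsPn vA] sub vB; apply/andP; split.
  by apply/existsP; exists i.
apply/existsPn=> j; apply: contra (vA j); rewrite !inE.
by case/orP=> [->//|/sub->]; rewrite orbT.
Qed.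

Lemma ownP a b A B v : v \in own b a B A ->
  (exists i, v \in b :: B i) /\ forall i, v \notin a :: A i.
Proof. by rewrite inE => /andP[/existsP vB /existsPn vA]. Qed.

Lemma hub_root_neq a b x u :
  u != a -> u != b -> (forall i, u != x i) -> forall v, hub_root a b x v != u.
Proof. by move=> ua ub ux [[]|i]; rewrite /= eq_sym. Qed.

Lemma minor_contract e a b x u y :
    symmetric e -> e u y -> u != a -> u != b -> (forall i, u != x i) ->
    rooted_minor (contract e u y) (hub_rel q) (hub_root a b x) ->
  rooted_minor e (hub_rel q) (hub_root a b x).
Proof.
by move=> es euy ua ub ux; apply: rooted_minor_contract => //; exact: hub_root_neq.
Qed.

(** [w] is the neighbour of [a] meant for the bag of [b]. If the hubs are not adjacent in the
    pattern, [w = b] may be taken with no adjacency required. *)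
Definition solvable n := forall e a b x A B w,
  length_sum A + length_sum B < n -> walk_system e a b x A B ->
  w \in own b a B A -> (q || (w != b) -> e a w) ->
  rooted_minor e (hub_rel q) (hub_root a b x).

Section Step.
Variables (e : rel T) (a b : T) (x : I -> T) (A B : I -> seq T) (w : T).
Hypothesis sys : walk_system e a b x A B.
Hypothesis w_own : w \in own b a B A.
Hypothesis aw : q || (w != b) -> e a w.
Hypothesis IH : solvable (length_sum A + length_sum B).
Let minor := rooted_minor e (hub_rel q) (hub_root a b x).

Lemma neq_end u i : u \notin A i \/ u \notin B i -> u != x i.
Proof. by have [xA xB] := walk_end_in i sys; case; apply: contraNneq => ->. Qed.

Lemma w_notinA i : w \notin A i.
Proof. by have [_ /(_ i)] := ownP w_own; rewrite inE => /norP[]. Qed.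

Lemma w_neq_a : w != a.
Proof. by have [[i _] /(_ i)] := ownP w_own; rewrite inE => /norP[]. Qed.

Lemma notin_B_walk i j v : v \in A i -> v \notin B i -> v \notin b :: B j.
Proof.
have [_ _ _ dis ab] := sys; move=> vA vB; apply/negP=> vBj.
have ij : i = j by apply: (dis _ _ v); rewrite // inE vA orbT.
move: vBj; rewrite -ij inE (negPf vB) orbF => /eqP vb.
by have [_] := ab i; rewrite -vb inE vA orbT.
Qed.

Lemma notin_A_walk i j v : v \in B i -> v \notin A i -> v \notin a :: A j.
Proof.
have [_ _ _ dis ab] := sys; move=> vB vA; apply/negP=> vAj.
have ij : j = i by apply: (dis _ _ v); rewrite // inE vB orbT.
move: vAj; rewrite ij inE (negPf vA) orbF => /eqP va.
by have [na _] := ab i; move: na; rewrite -va inE vB orbT.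
Qed.

Lemma split_inner i u : u \in B i -> u \notin A i ->
  exists p1 c p2, B i = p1 ++ u :: c :: p2 /\ e (last b p1) u /\ e u c.
Proof.
have [_ _ wB _ _] := sys; have [pB lB _] := wB i.
case/in_split=> p1 [[|c p2] Bi] uA.
  by have [xA _] := walk_end_in i sys; move: lB uA; rewrite Bi last_cat /= => ->; rewrite xA.
exists p1, c, p2; split=> //; move: pB; rewrite Bi cat_path /=.
by case/and4P.
Qed.

(** [u] is contracted into its predecessor on [B i]. The edge from [a] to [w] survives since [u] is
    neither end. *)
Lemma step_single_B i u :
    u \in B i -> u \notin A i -> (forall j, j != i -> u \notin B j) -> u != b -> u != w ->
  minor.
Proof.
move=> uB uA uj ub uw; have [es wA wB dis ab] := sys.
have [p1 [c [p2 [Bi [elu euc]]]]] := split_inner uB uA.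
have sys' := walk_systemC (remove_single (walk_systemC sys) Bi uA uj (or_introl (erefl _))).
have ua : u != a by have := notin_A_walk i uB uA; rewrite inE => /norP[].
have ux j : u != x j.
  by apply: neq_end; left; have := notin_A_walk j uB uA; rewrite inE => /norP[].
apply: (minor_contract es _ ua ub ux); first by rewrite es; exact: elu.
apply: (IH _ sys' (w := w)).
- by rewrite ltn_add2l length_sum_upd_lt // Bi !size_cat /= ltn_add2l.
- have [[k wBk] _] := ownP w_own.
  apply: (own_sub (i := k) w_own) => [j v //|]; rewrite /upd /=; case: eqP => // ki.
  move: wBk; rewrite ki Bi !inE !mem_cat !inE.
  by rewrite [w == u]eq_sym (negPf uw).
- by move/aw; apply: contract_keep; rewrite eq_sym.
Qed.

Lemma step_single_A i u :
    u \in A i -> u \notin B i -> (forall j, j != i -> u \notin A j) -> u != a ->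
  minor.
Proof.
move=> uA uB uj ua; have [es wA wB dis ab] := sys.
have [pA lA _] := wA i; have [_ xB] := walk_end_in i sys.
have [p1 [[|c p2] Ai]] := in_split uA.
  by move: lA uB; rewrite Ai last_cat /= => ->; rewrite xB.
have sys' := remove_single sys Ai uB uj (or_introl (erefl _)).
have ub : u != b by have := notin_B_walk i uA uB; rewrite inE => /norP[].
have ux j : u != x j.
  by apply: neq_end; right; have := notin_B_walk j uA uB; rewrite inE => /norP[].
move: pA; rewrite Ai cat_path /= => /and3P[_ elu _].
apply: (minor_contract es _ ua ub ux); first by rewrite es; exact: elu.
apply: (IH _ sys' (w := w)).
- by rewrite ltn_add2r length_sum_upd_lt // Ai !size_cat /= ltn_add2l.
- have [[k wBk] _] := ownP w_own; apply: (own_sub w_own) wBk.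
  by apply: upd_sub => v; rewrite Ai => /(mem_skip [:: u]).
- move/aw; apply: contract_keep; first by rewrite eq_sym.
  by apply: contraNneq (w_notinA i) => ->.
Qed.

(** The merge can cut a segment out of [B i], so [w] has to be [b] or be held by another B-walk. *)
Lemma step_crossing_A i z z' p1 p2 :
    A i = p1 ++ z :: z' :: p2 -> z \in B i -> z' \in B i ->
    (w = b \/ exists2 j, j != i & w \in B j) ->
  minor.
Proof.
move=> Ai zB z'B wj; have [es wA wB dis ab] := sys; have [pA _ _] := wA i.
have zA : z \in A i by rewrite Ai mem_cat inE eqxx orbT.
have [s [sub le sys']] := merge_crossing sys Ai zB z'B.
have [za zb /(_ (not_last wA Ai)) zx] := crossing_neq sys zA zB.
move: pA; rewrite Ai cat_path /= => /and4P[_ _ ezz' _].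
apply: (minor_contract es ezz' za zb zx).
apply: (IH _ sys' (w := w)).
- rewrite -addSn leq_add ?length_sum_upd_le //.
  by rewrite length_sum_upd_lt // Ai !size_cat /= ltn_add2l.
- have sA : forall j, {subset upd A i (p1 ++ z' :: p2) j <= A j}.
    by apply: upd_sub => v; rewrite Ai => /(mem_skip [:: z]).
  case: wj => [wb|[j ji wBj]].
    by apply: (own_sub (i := i) w_own) => //; rewrite wb mem_head.
  by apply: (own_sub (i := j) w_own) => //; rewrite /upd (negPf ji) inE wBj orbT.
- move/aw; apply: contract_keep; first by rewrite eq_sym.
  by apply: contraNneq (w_notinA i) => ->.
Qed.

(** Here [B i] loses only [z], which is on [A i] and so differs from [w]. The segment is cut out of
    [A i], which keeps [w] B-only. *)
Lemma step_crossing_B i z z' p1 p2 :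
  B i = p1 ++ z :: z' :: p2 -> z \in A i -> z' \in A i -> minor.
Proof.
move=> Bi zA z'A; have [es wA wB dis ab] := sys; have [pB lB uB] := wB i.
have zB : z \in B i by rewrite Bi mem_cat inE eqxx orbT.
have [s [sub le /walk_systemC sys']] := merge_crossing (walk_systemC sys) Bi zA z'A.
have [za zb /(_ (not_last wB Bi)) zx] := crossing_neq sys zA zB.
move: pB; rewrite Bi cat_path /= => /and4P[_ _ ezz' _].
have wz : w != z by apply: contraNneq (w_notinA i) => ->.
apply: (minor_contract es ezz' za zb zx).
apply: (IH _ sys' (w := w)).
- rewrite -addnS leq_add ?length_sum_upd_le //.
  by rewrite length_sum_upd_lt // Bi !size_cat /= ltn_add2l.
- have [[k wBk] _] := ownP w_own.
  apply: (own_sub (i := k) w_own) => [|]; first exact: upd_sub.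
  rewrite /upd /=; case: eqP => // ki.
  by move: wBk; rewrite ki Bi !inE !mem_cat !inE (negPf wz).
- by move/aw; apply: contract_keep; rewrite // eq_sym.
Qed.

(* The later of the two neighbours of w on A i absorbs w.  As a is adjacent
   to w, the walk A i may then start at that neighbour, and its former second
   vertex, now only on B i, takes over the role of w. *)
Lemma step_target i :
  w \in B i -> (forall j, j != i -> w \notin B j) -> w != b -> minor.
Proof.
move=> wBi wj wb; have [es wA wB dis ab] := sys.
have eaw : e a w by apply: aw; rewrite wb orbT.
have aw' : a != w by rewrite eq_sym w_neq_a.
have [p1 [y [p2 [Bi [elw ewy]]]]] := split_inner wBi (w_notinA i).
set t := last b p1 in elw.
have sys' v : v = t \/ v = y ->
    walk_system (contract e w v) a b x A (upd B i (p1 ++ y :: p2)).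
  by move/(remove_single (walk_systemC sys) Bi (w_notinA i) wj)/walk_systemC.
have lift v : v = t \/ v = y ->
    rooted_minor (contract e w v) (hub_rel q) (hub_root a b x) -> minor.
  move=> vE; apply: minor_contract => //; last 1 first.
  - by move=> j; apply: neq_end; left; exact: w_notinA.
  - by case: vE => ->; rewrite // es.
  - exact: w_neq_a.
have lt : length_sum (upd B i (p1 ++ y :: p2)) < length_sum B.
  by rewrite length_sum_upd_lt // Bi !size_cat /= ltn_add2l.
have Bi' : upd B i (p1 ++ y :: p2) i = p1 ++ y :: p2 by rewrite /upd eqxx.
have mem_new v : v = t \/ v = y -> v \in b :: p1 ++ y :: p2.
  by case=> ->; rewrite -cat_cons mem_cat ?mem_last // mem_head orbT.
have [na nb] := ab i.
have mem_old v : v = t \/ v = y -> v \in b :: B i.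
  by move/mem_new; rewrite Bi !inE => /orP[->//|/(mem_skip [:: w])->]; rewrite orbT.
(* A neighbour of [w] on [B i] that is off [A i] absorbs [w] and becomes the new target. *)
have absorb v : v = t \/ v = y -> v \notin A i -> minor.
  move=> vE vA; apply: (lift v vE); apply: (IH _ (sys' v vE) (w := v)).
  - by rewrite ltn_add2l.
  - apply: (mem_own (walk_systemC (sys' v vE)) (i := i)); first by rewrite Bi' mem_new.
    by rewrite inE negb_or vA andbT; apply: contraNneq na => <-; exact: mem_old.
  - by move=> _; exact: contract_to.
have [tA|] := boolP (t \in A i); last by apply: absorb; left.
have [yA|] := boolP (y \in A i); last by apply: absorb; right.
have [pA lA uA] := wA i.
case Ai : (A i) => [|c s]; first by rewrite Ai in yA.
have cA : c \in A i by rewrite Ai mem_head.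
have eac : e a c by move: pA; rewrite Ai => /andP[].
have ca : c != a by apply: contraTneq cA => ->; case/andP: uA.
have wc : w != c by apply: contraNneq (w_notinA i) => ->.
have [cB|cB] := boolP (c \in B i); last first.
  have cBj j : c \notin b :: B j by exact: notin_B_walk cA cB.
  have cb : c != b by have := cBj i; rewrite inE => /norP[].
  have cx j : c != x j by apply: neq_end; right; have := cBj j; rewrite inE => /norP[].
  apply: (minor_contract es _ ca cb cx); first by rewrite es; exact: eac.
  apply: (IH _ (absorb_hub sys ca eac cBj) (w := w)).
  - rewrite ltn_add2r; apply: (@length_sum_lt _ _ i) => [j|].
      by case: ifP => //; rewrite size_drop leq_subr.
    by rewrite cA Ai /= eqxx drop0.
  - have [[k wBk] _] := ownP w_own; apply: (own_sub w_own) wBk => j v.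
    by case: ifP => // _; exact: mem_drop.
  - by move=> _; apply: contract_keep; rewrite // eq_sym.
pose l := if index t (A i) < index y (A i) then y else t.
have lE : l = t \/ l = y by rewrite /l; case: ifP; [right|left].
have ty : t != y.
  have [_ _] := wB i; rewrite Bi -cat_cons cat_uniq => /and3P[_ /hasPn/(_ y)].
  by rewrite !inE eqxx orbT => /(_ isT) yp _; apply: contraNneq yp => <-; exact: mem_last.
(* As [t != y], the later of them is not first on [A i], so the first vertex [c] is cut off and
   becomes B-only. *)
have index_l : 0 < index l (A i).
  rewrite /l; case: (ltnP (index t (A i))) => [lt_ty|le]; first exact: leq_trans lt_ty.
  rewrite lt0n; apply: contraNneq ty => t0; move: le.
  rewrite t0 leqn0 => /eqP y0.
  by rewrite -(nth_index a tA) t0 -y0 nth_index.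
have lA' : l \in A i by case: lE => ->.
pose s' := drop (index l (A i)) (A i).
have s'E : s' = l :: drop (index l (A i)).+1 (A i).
  by rewrite /s' (drop_nth a) ?index_mem // nth_index.
have sub' : {subset s' <= A i} by move=> v; exact: mem_drop.
have sysl : walk_system (contract e w l) a b x (upd A i s') (upd B i (p1 ++ y :: p2)).
  have [es' wA' wB' _ _] := sys' l lE; have [pA' lA'' uA'] := wA' i.
  apply: (walk_system_sub (sys' l lE)) => [//||//||j v //]; last exact: upd_sub.
  apply: walks_upd => [j _|]; first exact: wA'.
  have sA : A i = take (index l (A i)) (A i) ++ s' by rewrite cat_take_drop.
  split.
  - move: pA'; rewrite {1}sA cat_path s'E /= => /and3P[_ _ ->].
    by rewrite contract_to.
  - by move: lA''; rewrite {1}sA last_cat s'E.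
  - apply: subseq_uniq uA'; rewrite /= eqxx; exact: drop_subseq.
apply: (lift l lE); apply: (IH _ sysl (w := c)).
- rewrite -addnS leq_add // length_sum_upd_le //.
  by rewrite size_drop leq_subr.
- apply: (mem_own (walk_systemC sysl) (i := i)).
    move: cB; rewrite Bi' Bi !inE !mem_cat !inE [c == w]eq_sym (negPf wc) /=.
    by move=> ->; rewrite orbT.
  rewrite /upd eqxx inE negb_or ca /= /s' Ai.
  move: index_l uA; rewrite Ai; case: (index l _) => // k _ /=.
  by case/and3P=> _ cs _; apply: contra cs; exact: mem_drop.
- by move=> _; apply: contract_keep; rewrite // eq_sym.
Qed.

End Step.

Lemma not_path_split (r : rel T) (y : T) (s : seq T) :
  ~~ path r y s -> exists p1 z z' p2, y :: s = p1 ++ z :: z' :: p2 /\ ~~ r z z'.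
Proof.
elim: s y => //= c s IHs y; rewrite negb_and => /orP[nr|/IHs[p1 [z [z' [p2 [-> nr]]]]]].
  by exists [::], y, c, s.
by exists (y :: p1), z, z', p2.
Qed.

Lemma not_alternating_split e a b x A B i : walk_system e a b x A B ->
    ~~ path (fun z z' => ~~ ((z \in B i) && (z' \in B i))) a (A i) ->
  exists p1 z z' p2, [/\ A i = p1 ++ z :: z' :: p2, z \in B i & z' \in B i].
Proof.
case=> _ _ _ _ /(_ i)[na _] /not_path_split[[|c p1] [z [z' [p2 [[zE AE]]]]]].
  by rewrite negbK -zE; move: na; rewrite inE negb_or => /andP[_ /negPf->].
by rewrite negbK => /andP[zB z'B]; exists p1, z, z', p2.
Qed.

Lemma walk_system_minor e a b x A B w :
    walk_system e a b x A B -> w \in own b a B A -> (q || (w != b) -> e a w) ->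
  rooted_minor e (hub_rel q) (hub_root a b x).
Proof.
suff all_solvable n : solvable n by exact: (all_solvable _ _ _ _ _ _ _ _ (ltnSn _)).
elim: n => // n IHn {}e {}a {}b {}x {}A {}B {}w; rewrite ltnS => le sys w_own aw.
have IH : solvable (length_sum A + length_sum B).
  by move=> e' a' b' x' A' B' w' lt; apply: IHn; apply: leq_trans lt le.
have [/andP[wb /existsP[i /andP[wBi /forallP wj]]]|wmulti] :=
    boolP ((w != b) && [exists i, (w \in B i) && [forall j, (j != i) ==> (w \notin B j)]]).
  by apply: (step_target sys w_own aw IH wBi _ wb) => j; apply/implyP/wj.
(* Treating the target first secures this: crossings on A-walks can then be merged without losing
   [w], and [w] meets the requirement of [multiple B A]. *)
have wB i : w = b \/ exists2 j, j != i & w \in B j.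
  have [/eqP|wb] := boolP (w == b); [by left|right].
  have [[k]] := ownP w_own; rewrite inE (negPf wb) /= => wBk _.
  have [ki|ki] := eqVneq k i; last by exists k.
  move: wmulti; rewrite wb /= => /existsPn/(_ k); rewrite wBk /= => /forallPn[j].
  by rewrite negb_imply negbK ki => /andP[ji wBj]; exists j.
have [/existsP[i /existsP[u /and4P[uA uB ua /forallP uj]]]|mulA] := boolP [exists i,
    exists u, [&& u \in A i, u \notin B i, u != a & [forall j, (j != i) ==> (u \notin A j)]]].
  by apply: (step_single_A sys w_own aw IH uA uB _ ua) => j; apply/implyP/uj.
have [/existsP[i /existsP[u /and5P[uB uA ub uw /forallP uj]]]|mulB] := boolP [exists i,
    exists u, [&& u \in B i, u \notin A i, u != b, u != w &
      [forall j, (j != i) ==> (u \notin B j)]]].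
  by apply: (step_single_B sys w_own aw IH uB uA _ ub uw) => j; apply/implyP/uj.
have [/forallP altA|/forallPn[i]] := boolP [forall i,
    path (fun z z' => ~~ ((z \in B i) && (z' \in B i))) a (A i)]; last first.
  case/(not_alternating_split sys) => p1 [z [z' [p2 [Ai zB z'B]]]].
  exact: (step_crossing_A sys w_own aw IH Ai zB z'B (wB i)).
have [/forallP altB|/forallPn[i]] := boolP [forall i,
    path (fun z z' => ~~ ((z \in A i) && (z' \in A i))) b (B i)]; last first.
  case/(not_alternating_split (walk_systemC sys)) => p1 [z [z' [p2 [Bi zA z'A]]]].
  exact: (step_crossing_B sys w_own aw IH Bi zA z'A).
have [_ wlkA wlkB _ _] := sys.
apply: (alternating_minor sys altA altB _ _ w_own) => [i u uA uB|i u uB uA|qT].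
- have ua : u != a by apply: contraTneq uA => ->; have [_ _ /andP[]] := wlkA i.
  move: mulA => /existsPn/(_ i)/existsPn/(_ u); rewrite uA uB ua /= => /forallPn[j].
  by rewrite negb_imply negbK => /andP[]; exists j.
- have ub : u != b by apply: contraTneq uB => ->; have [_ _ /andP[]] := wlkB i.
  have [uw|uw] := eqVneq u w.
    by have [wb|] := wB i; [rewrite -wb uw eqxx in ub|rewrite uw].
  move: mulB => /existsPn/(_ i)/existsPn/(_ u); rewrite uA uB ub uw /= => /forallPn[j].
  by rewrite negb_imply negbK => /andP[]; exists j.
- by apply: aw; rewrite qT.
Qed.

End Reduction.

(* The initial segment of the path outside the walks of b is absorbed by a, so
   that a becomes adjacent to a vertex of these walks, which is not on the
   walks of a. *)
Lemma hub_path_minor (T I : finType) (e : rel T) (a b : T) (x : I -> T)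
    (A B : I -> seq T) (i0 : I) (p : seq T) :
    walk_system e a b x A B -> path e a p -> last a p = b -> uniq (a :: p) ->
    (forall i v, v \in p -> v \in A i -> v \notin B i) ->
  rooted_minor e (hub_rel true) (hub_root a b x).
Proof.
elim: p e A => [|u p IHp] e A sys /=; have [es _ _ dis ab] := sys.
  by move=> _ ab'; have [] := ab i0; rewrite ab' mem_head.
case/andP=> eau pu lb /and3P[]; rewrite inE negb_or eq_sym => /andP[ua ap] up uniqp apart.
have [/existsP[i uB]|/existsPn uB] := boolP [exists i, u \in b :: B i].
  apply: (walk_system_minor sys (w := u)) => //; apply: (mem_own (walk_systemC sys) uB).
  rewrite inE negb_or ua /=; apply/negP=> uA.
  have := apart i u (mem_head _ _) uA; move: uB; rewrite inE => /orP[/eqP ub|->] // _.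
  by have [_] := ab i; rewrite -ub inE uA orbT.
have ub : u != b by have := uB i0; rewrite inE => /norP[].
have ux j : u != x j.
  have [_ xB] := walk_end_in j sys.
  by apply: contraNneq (uB j) => ->; rewrite inE xB orbT.
apply: (minor_contract es _ ua ub ux); first by rewrite es; exact: eau.
case: p => [|c p] in IHp pu lb ap up uniqp apart *; first by rewrite -lb eqxx in ub.
move: pu up => /= /andP[euc pc]; rewrite inE negb_or => /andP[uc up].
apply: IHp (absorb_hub sys ua eau uB) _ _ _ _ => //.
- rewrite /= contract_from ?path_contract // ?inE ?negb_or ?uc //.
  by rewrite eq_sym.
- by rewrite /= ap.
- move=> i v vp; case: ifP => [_ /mem_drop|_]; apply: apart; by rewrite inE vp orbT.
Qed.

(** * Schemes *)

Lemma uv_path_walk (G : sgraph) (y z : G) (s : seq G) : uv_path y z s ->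
  exists p, [/\ path (@adj G) y p, last y p = z, uniq (y :: p) & y :: p =i s].
Proof.
case/orP; case: s => // c p /and4P[/eqP-> pp /eqP lp up]; first by exists p.
have revE : rev (z :: p) = y :: rev (belast z p) by rewrite lastI rev_rcons lp.
exists (rev (belast z p)); split.
- rewrite -lp rev_path; apply: sub_path pp => v w; by rewrite adj_sym.
- by have := f_equal (last y) revE; rewrite rev_cons last_rcons.
- by rewrite -revE rev_uniq.
- by move=> v; rewrite -revE mem_rev.
Qed.

Section Scheme.
Variables (H G : sgraph) (f : H -> G) (I : finType).
Variables (ha hb : H) (hx : I -> H) (P : {set H} -> seq G).
Hypotheses (f_inj : injective f) (schemeP : is_scheme f P).
Hypotheses (hx_inj : injective hx) (hab : ha != hb).
Hypotheses (adj_ax : forall i, adj ha (hx i)) (adj_bx : forall i, adj hb (hx i)).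

Lemma adj_neq (u v : H) : adj u v -> u != v.
Proof. by apply: contraTneq => ->; rewrite adj_irrefl. Qed.

Lemma scheme_common (E : seq {set H}) (v : G) :
    E != [::] -> (forall h, h \in E -> h \in edges H) -> (forall h, h \in E -> v \in P h) ->
  exists u, forall h, h \in E -> u \in h.
Proof.
move=> E0 Eedges vE; have [_ /(_ [set h in E])] := schemeP.
case=> [|||u uE].
- by case: E E0 {Eedges vE} => // h E _; apply/set0Pn; exists h; rewrite !inE eqxx.
- by apply/subsetP=> h; rewrite inE => /Eedges.
- apply/set0Pn; exists v; apply/bigcapP=> h; rewrite !inE => hE.
  exact: vE.
- by exists u => h hE; apply: uE; rewrite inE.
Qed.

Lemma mem_edges (u v : H) : adj u v -> [set u; v] \in edges H.
Proof.
by move=> uv; rewrite inE; apply/existsP; exists u; apply/existsP; exists v; rewrite uv eqxx.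
Qed.

Lemma scheme_root (u v w : H) : adj u v -> f w \in P [set u; v] -> (w == u) || (w == v).
Proof.
have [/(_ u v) ends _] := schemeP => /ends[_ /setP/(_ (f w))].
by rewrite !inE imset_f // andbT => -> /orP[]/eqP/f_inj->; rewrite eqxx ?orbT.
Qed.

(** A common vertex of the paths from [ha] to [hx i] and from [hb] to [hx j] forces a common end of
    these two edges, which can only be [hx i = hx j]. *)
Lemma scheme_walk_system : exists A B,
  [/\ walk_system (@adj G) (f ha) (f hb) (f \o hx) A B,
      forall i v, v \in A i -> v \in P [set ha; hx i]
    & forall i v, v \in B i -> v \in P [set hb; hx i]].
Proof.
have [ends _] := schemeP.
have [A wA] := fin_all_exists (fun i => uv_path_walk (ends _ _ (adj_ax i)).1).
have [B wB] := fin_all_exists (fun i => uv_path_walk (ends _ _ (adj_bx i)).1).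
have memA i : f ha :: A i =i P [set ha; hx i] by case: (wA i).
have memB i : f hb :: B i =i P [set hb; hx i] by case: (wB i).
exists A, B; split=> [|i v vA|i v vB].
- split; [exact: adj_sym| by move=> i; case: (wA i)|by move=> i; case: (wB i)| |].
    move=> i j v; rewrite memA memB => vA vB.
    have [||h|u uE] := @scheme_common [:: [set ha; hx i]; [set hb; hx j]] v => //.
      by move=> h; rewrite !in_cons orbF => /orP[]/eqP->; rewrite mem_edges.
      by rewrite !in_cons orbF => /orP[]/eqP->.
    have := uE [set hb; hx j]; have := uE _ (mem_head _ _).
    rewrite !inE eqxx orbT => uA /(_ isT) uB.
    case/orP: uA uB => /eqP->; first by rewrite (negPf hab) (negPf (adj_neq (adj_ax j))).
    by rewrite eq_sym (negPf (adj_neq (adj_bx i))) /= => /eqP/hx_inj.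
  move=> i; split; [rewrite memB|rewrite memA].
    apply/negP=> /(scheme_root (adj_bx i)).
    by rewrite (negPf hab) (negPf (adj_neq (adj_ax i))).
  apply/negP=> /(scheme_root (adj_ax i)).
  by rewrite eq_sym (negPf hab) (negPf (adj_neq (adj_bx i))).
- by rewrite -memA inE vA orbT.
- by rewrite -memB inE vB orbT.
Qed.

Lemma scheme_hub_minor : I ->
  rooted_minor (@adj G) (@hub_rel I (adj ha hb)) (hub_root (f ha) (f hb) (f \o hx)).
Proof.
move=> i0; have [A [B [sys memA memB]]] := scheme_walk_system.
have [_ _ _ _ ab] := sys.
case hab_adj: (adj ha hb); last first.
  apply: (walk_system_minor sys (w := f hb)); last by rewrite eqxx.
  by apply: (mem_own (walk_systemC sys) (i := i0)); [exact: mem_head|case: (ab i0)].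
have [ends _] := schemeP; have [p [pp lp up memp]] := uv_path_walk (ends _ _ hab_adj).1.
apply: (hub_path_minor i0 sys pp lp up) => i v vp vA; apply/negP=> vB.
(* The edges of the triangle on [ha], [hb], [hx i] have no common end, so the hub path avoids all
   common vertices of [A i] and [B i]. *)
have [||h|u uE] := @scheme_common [:: [set ha; hb]; [set ha; hx i]; [set hb; hx i]] v => //.
  by move=> h; rewrite !in_cons orbF => /or3P[]/eqP->; rewrite mem_edges.
  rewrite !in_cons orbF => /or3P[]/eqP->; [|exact: memA|exact: memB].
  by rewrite -memp inE vp orbT.
have := uE [set hb; hx i]; have := uE [set ha; hx i]; have := uE [set ha; hb].
rewrite !inE !eqxx !orbT => /(_ isT) u1 /(_ isT) u2 /(_ isT) u3.
case/orP: u1 u2 u3 => /eqP->; first by rewrite (negPf hab) (negPf (adj_neq (adj_ax i))).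
by rewrite eq_sym (negPf hab) (negPf (adj_neq (adj_bx i))).
Qed.

End Scheme.

(** * From hub patterns to contractible graphs *)

Lemma hub_rooted_minor (H G : sgraph) (f : H -> G) (I : finType) (q : bool) a b x
    (k : H -> bool + I) :
    injective k -> (forall v, hub_root a b x (k v) = f v) ->
    (forall u v, adj u v -> hub_rel q (k u) (k v)) ->
    rooted_minor (@adj G) (@hub_rel I q) (hub_root a b x) ->
  has_rooted_minor f.
Proof.
move=> k_inj kf k_adj [C [conn dis root touch]].
have sym v : symmetric [rel y z | [&& y \in C (k v), z \in C (k v) & adj y z]].
  by move=> y z; rewrite /= andbCA adj_sym.
have sub v y z : [rel y z | [&& y \in C (k v), z \in C (k v) & adj y z]] y z ->
  [/\ y \in C (k v), z \in C (k v) & adj y z] by case/and3P.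
exists (fun v => Subgraph (sym v) (sub v)); split=> [v|u v uv|v|u v uv] /=.
- split; last exact: conn.
  by apply/set0Pn; exists (f v); rewrite -kf root.
- by apply: dis; rewrite (inj_eq k_inj).
- by rewrite -kf root.
- exact/touch/k_adj.
Qed.

Lemma hub_contractible (H : sgraph) (I : finType) (ha hb : H) (hx : I -> H)
    (k : H -> bool + I) :
    I -> cancel k (hub_root ha hb hx) -> injective hx -> ha != hb ->
    (forall i, adj ha (hx i)) -> (forall i, adj hb (hx i)) ->
    (forall i j, ~~ adj (hx i) (hx j)) ->
  contractible H.
Proof.
move=> i0 kK hx_inj hab adj_ax adj_bx nadj_x G f f_inj [P schemeP].
have := scheme_hub_minor f_inj schemeP hx_inj hab adj_ax adj_bx i0.
apply: (hub_rooted_minor (can_inj kK)) => [v|u v].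
  by rewrite -{2}(kK v); case: (k v) => [[]|].
rewrite -{1}(kK u) -{1}(kK v); case: (k u) => [[]|i]; case: (k v) => [[]|j] //=.
- by rewrite adj_irrefl.
- by rewrite andbT.
- by rewrite adj_sym andbT.
- by rewrite adj_irrefl.
- by rewrite (negPf (nadj_x i j)).
Qed.

Theorem theorem6p2 :
  contractible (complete_multipartite [:: 2; 3]) /\
  contractible (complete_multipartite [:: 1; 1; 3]).
Proof.
split.
- pose part (i : nat) (lt : i < 2) : 'I_(size [:: 2; 3]) := Ordinal lt.
  pose H := complete_multipartite [:: 2; 3].
  pose ha : H := existT _ (part 0 isT) (@Ordinal 2 0 isT).
  pose hb : H := existT _ (part 0 isT) (@Ordinal 2 1 isT).
  pose hx (i : 'I_3) : H := existT _ (part 1 isT) i.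
  (* Both hubs lie in part 0 and are told apart by their place in it. *)
  pose k (v : H) : bool + 'I_3 :=
    if val (tag v) == 0 then inl (val (tagged v) == 0) else inr (inord (val (tagged v))).
  apply: (@hub_contractible _ _ ha hb hx k ord0) => [v|i j||//|//|//].
    case: v => [[[|[|m]] hi] y] //; rewrite /k /=; move: y; rewrite (bool_irrelevance hi isT).
      move=> [[|[|m]] hy] //=; rewrite (bool_irrelevance hy isT) //.
    by move=> y; congr existT; apply: val_inj; rewrite /= inordK.
    by move/(f_equal (fun v : H => val (tagged v))) => /= /val_inj.
  by apply/eqP=> /(f_equal (fun v : H => val (tagged v))).
- pose part (i : nat) (lt : i < 3) : 'I_(size [:: 1; 1; 3]) := Ordinal lt.
  pose H := complete_multipartite [:: 1; 1; 3].
  pose ha : H := existT _ (part 0 isT) (@Ordinal 1 0 isT).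
  pose hb : H := existT _ (part 1 isT) (@Ordinal 1 0 isT).
  pose hx (i : 'I_3) : H := existT _ (part 2 isT) i.
  (* Here the hubs form the singleton parts 0 and 1 and are told apart by the tag. *)
  pose k (v : H) : bool + 'I_3 :=
    if val (tag v) < 2 then inl (val (tag v) == 0) else inr (inord (val (tagged v))).
  apply: (@hub_contractible _ _ ha hb hx k ord0) => [v|i j||//|//|//].
    case: v => [[[|[|[|m]]] hi] y] //; rewrite /k /=; move: y; rewrite (bool_irrelevance hi isT).
    + by move=> [[|m] hy] //=; rewrite (bool_irrelevance hy isT).
    + by move=> [[|m] hy] //=; rewrite (bool_irrelevance hy isT).
    by move=> y; congr existT; apply: val_inj; rewrite /= inordK.
    by move/(f_equal (fun v : H => val (tagged v))) => /= /val_inj.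
  by apply/eqP=> /(f_equal (fun v : H => val (tag v))).
Qed.
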